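(* The reciprocal map $':\mathcal{R}^n\to\mathcal{R}^n$ is convex with respect to the addition $\oplus$: for every $K,T\in\mathcal{R}^n$ and $0\le\lambda\le1$, $$\left((1-\lambda)K\oplus\lambda T\right)'\subseteq(1-\lambda)K'\oplus\lambda T'.$$
   Context: A convex body in $\mathbb{R}^n$ is a closed convex set $K\subseteq\mathbb{R}^n$ with $0\in K$ (not assumed compact, nor with non-empty interior); $\mathcal{K}_0^n$ is the set of all convex bodies. The support function of $K$ is $h_K:S^{n-1}\to[0,\infty]$, $h_K(\theta)=\sup_{x\in K}\langle x,\theta\rangle$. For $g:S^{n-1}\to[0,\infty]$, $A[g]=\{x\in\mathbb{R}^n:\langle x,\theta\rangle\le g(\theta)\text{ for all }\theta\in S^{n-1}\}$. The reciprocal body of $K\in\mathcal{K}_0^n$ is $K'=A[1/h_K]\in\mathcal{K}_0^n$, with $1/0=\infty$, $1/\infty=0$. $\mathcal{R}^n=\{K':K\in\mathcal{K}_0^n\}$. A star set is a non-empty $A\subseteq\mathbb{R}^n$ such that $x\in A$ and $0\le\lambda\le1$ imply $\lambda x\in A$; its radial function is $r_A(\theta)=\sup\{\lambda\ge0:\lambda\theta\in A\}\in[0,\infty]$. A star body is a star set $A$ with $r_A(\theta)\theta\in A$ for all $\theta\in S^{n-1}$ with $r_A(\theta)<\infty$; it is uniquely determined by $r_A$. For $K\in\mathcal{K}_0^n$, the flower $K^{\clubsuit}$ is the star body with radial function $r_{K^{\clubsuit}}=h_K$; the map $K\mapsto K^{\clubsuit}$ is injective. The Minkowski sum of two flowers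 is again the flower of a unique convex body, and the addition $\oplus$ on $\mathcal{K}_0^n$ is defined implicitly by $K^{\clubsuit}+T^{\clubsuit}=(K\oplus T)^{\clubsuit}$, where $+$ is Minkowski addition. $\lambda K=\{\lambda x:x\in K\}$.
   Formalization: The addition ⊕ is defined by equality of the radial functions of (K⊕T)♣ and K♣+T♣, not by equality of sets, since for some unbounded K, T (a ray and a segment) K♣+T♣ is not a star body; the two agree whenever it is. *)

(* Defs.v *)
From HB Require Import structures.
From mathcomp Require Import all_boot all_order all_algebra.
From mathcomp Require Import all_classical all_reals all_analysis.
From mathcomp Require Import ring lra.
Import Order.TTheory GRing.Theory Num.Theory.
Import numFieldNormedType.Exports.

Set Implicit Arguments.
Unset Strict Implicit.
Unset Printing Implicit Defensive.

Local Open Scope classical_set_scope.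
Local Open Scope ring_scope.

Section Definitions.
Context {R : realType} {n : nat}.
Implicit Types (K T A B : set 'rV[R]_n) (g : 'rV[R]_n -> \bar R).

Definition dot (x y : 'rV[R]_n) : R := (x *m y^T) 0 0.

Definition sphere : set 'rV[R]_n := [set u | dot u u = 1].

Definition convex_body K := [/\ closed K, convex_set K & K 0].

Definition support K (u : 'rV[R]_n) : \bar R :=
  ereal_sup [set (dot x u)%:E | x in K].

(* g stands for a function on the sphere; its other values are irrelevant. *)
Definition alexandrov g : set 'rV[R]_n :=
  [set x | forall u, sphere u -> ((dot x u)%:E <= g u)%E].

(* On extended reals 0^-1 = +oo and +oo^-1 = 0. *)
Definition reciprocal K : set 'rV[R]_n :=
  alexandrov (fun u => ((support K u)^-1)%E).

Definition reciprocal_bodies : set (set 'rV[R]_n) :=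
  [set reciprocal K | K in convex_body].

Definition star_set A :=
  A !=set0 /\ forall x (l : R), A x -> 0 <= l <= 1 -> A (l *: x).

Definition radial A (u : 'rV[R]_n) : \bar R :=
  ereal_sup [set l%:E | l in [set l : R | 0 <= l /\ A (l *: u)]].

Definition star_body A := star_set A /\
  forall u, sphere u -> (radial A u < +oo)%E -> A (fine (radial A u) *: u).

(* The star body with radial function g, for g >= 0 on the sphere; see
   radial_star_body_of, star_body_star_body_of and star_body_of_radial. *)
Definition star_body_of g : set 'rV[R]_n :=
  [set x | forall u (l : R), sphere u -> 0 <= l -> x = l *: u -> (l%:E <= g u)%E].

Definition flower K : set 'rV[R]_n := star_body_of (support K).

Definition minkowski_sum A B : set 'rV[R]_n :=
  [set x + y | x in A & y in B].

Definition dilate (l : R) A : set 'rV[R]_n := [set l *: x | x in A].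

(* The implicit equation flower W = flower K + flower T holds between star
   bodies, i.e. between radial functions: for non-compact K the Minkowski sum
   can miss boundary points of the star body it determines. For instance, in
   dimension at least 2, with e a unit vector, K the ray [0, +oo) e and T the
   segment [-e, 0], the sum is the open half-space {<x, e> > -1} together with
   the single point -e, which is not a star body. *)
Definition is_oplus K T W := convex_body W /\
  flower W = star_body_of (radial (minkowski_sum (flower K) (flower T))).

(* The body W is unique because flower is injective on convex bodies, and it
   exists by oplusP below. *)
Definition oplus K T : set 'rV[R]_n := xget set0 (is_oplus K T).

End Definitions.

Section Facts.
Context {R : realType} {n : nat}.
Implicit Types (K T A B W : set 'rV[R]_n) (x y u v : 'rV[R]_n).

Lemma dotC x y : dot x y = dot y x.
Proof. by rewrite /dot !mxE; apply: eq_bigr => i _; rewrite !mxE mulrC. Qed.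

Lemma dotDl x y u : dot (x + y) u = dot x u + dot y u.
Proof. by rewrite /dot mulmxDl mxE. Qed.

Lemma dotZl (a : R) x u : dot (a *: x) u = a * dot x u.
Proof. by rewrite /dot -scalemxAl mxE. Qed.

Lemma dotDr x y u : dot u (x + y) = dot u x + dot u y.
Proof. by rewrite dotC dotDl !(dotC u). Qed.

Lemma dotZr (a : R) x u : dot u (a *: x) = a * dot u x.
Proof. by rewrite dotC dotZl dotC. Qed.

Lemma dot0l u : dot 0 u = 0.
Proof. by rewrite /dot mul0mx mxE. Qed.

Definition dotE := (dotDl, dotDr, dotZl, dotZr).

Lemma dot_ge0 x : 0 <= dot x x.
Proof. by rewrite /dot mxE sumr_ge0// => i _; rewrite mxE -expr2 sqr_ge0. Qed.

Lemma dot_eq0 x : dot x x = 0 -> x = 0.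
Proof.
rewrite /dot mxE => /eqP; rewrite psumr_eq0; last first.
  by move=> i _; rewrite mxE -expr2 sqr_ge0.
move=> /allP h; apply/rowP => i; rewrite mxE.
have := h i (mem_index_enum _); rewrite /= mxE -expr2 sqrf_eq0 => /eqP ->.
by [].
Qed.

Lemma CauchySchwarz x y : dot x y <= Num.sqrt (dot x x) * Num.sqrt (dot y y).
Proof.
set a := Num.sqrt _; set b := Num.sqrt _.
have a0 : 0 <= a by exact: sqrtr_ge0.
have b0 : 0 <= b by exact: sqrtr_ge0.
have ha : dot x x = a ^+ 2 by rewrite sqr_sqrtr// dot_ge0.
have hb : dot y y = b ^+ 2 by rewrite sqr_sqrtr// dot_ge0.
have [a00|a00] := eqVneq a 0.
  have -> : x = 0 by apply: dot_eq0; rewrite ha a00 expr0n.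
  by rewrite dot0l mulr_ge0.
have [b00|b00] := eqVneq b 0.
  have -> : y = 0 by apply: dot_eq0; rewrite hb b00 expr0n.
  by rewrite dotC dot0l mulr_ge0.
have ab : 0 < a * b by rewrite mulr_gt0// lt_neqAle eq_sym ?a00 ?b00.
have := dot_ge0 (b *: x + (- a) *: y).
rewrite !dotE (dotC y x) ha hb => h.
rewrite -(ler_pM2l ab); nra.
Qed.

Lemma sphere_decomp x : x != 0 ->
  exists u, sphere u /\ x = Num.sqrt (dot x x) *: u.
Proof.
move=> x0; set a := Num.sqrt _.
have ha : dot x x = a ^+ 2 by rewrite sqr_sqrtr// dot_ge0.
have a0 : a != 0.
  apply: contra x0 => /eqP a0; apply/eqP/dot_eq0.
  by rewrite ha a0 expr0n.
exists (a^-1 *: x); split; last by rewrite scalerA divff// scale1r.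
by rewrite /sphere /= !dotE ha; field.
Qed.

Lemma star_body_ofE (g : 'rV[R]_n -> \bar R) u (l : R) :
  (forall v, sphere v -> (0 <= g v)%E) -> sphere u -> 0 <= l ->
  star_body_of g (l *: u) <-> (l%:E <= g u)%E.
Proof.
move=> g0 su l0; split=> [|h]; first by move/(_ u l su l0 erefl).
move=> v m sv m0 e.
have lm : l = m.
  have : dot (l *: u) (l *: u) = dot (m *: v) (m *: v) by rewrite e.
  by rewrite !dotE su sv => h2; apply/eqP; rewrite -(@eqrXn2 _ 2)//; lra.
have [m00|m00] := eqVneq m 0; first by rewrite m00 g0.
suff -> : v = u by rewrite -lm.
by apply: (scalerI m00); rewrite -e lm.
Qed.

Lemma radial_star_body_of (g : 'rV[R]_n -> \bar R) u :
  (forall v, sphere v -> (0 <= g v)%E) -> sphere u ->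
  radial (star_body_of g) u = g u.
Proof.
move=> g0 su; apply/eqP; rewrite eq_le; apply/andP; split.
  apply: ge_ereal_sup => _ [l [l0 hl] <-].
  by rewrite -(star_body_ofE g0 su l0).
have := g0 u su; case E : (g u) => [r| |]// r0.
  apply: ereal_sup_ubound; exists r => //; split => //.
  by apply/(star_body_ofE g0 su _) => //; rewrite E.
rewrite leye_eq; apply/eqP/eqyP => r r1; apply: ereal_sup_ubound.
exists r => //; split; first exact: ltW.
by apply/(star_body_ofE g0 su _) => //; [exact: ltW|rewrite E leey].
Qed.

Lemma star_body_star_body_of (g : 'rV[R]_n -> \bar R) :
  (forall v, sphere v -> (0 <= g v)%E) -> star_body (star_body_of g).
Proof.
move=> g0; split; last first.
  move=> u su; rewrite radial_star_body_of// => h.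
  have := g0 u su; case E : (g u) h => [r| |]// _ r0.
  by apply/(star_body_ofE g0 su _) => //=; rewrite E.
split.
  exists 0 => u l su l0 /esym/eqP; rewrite scaler_eq0 => /orP[/eqP ->|/eqP u0].
    exact: g0.
  by move: su; rewrite /sphere /= u0 dot0l => /esym/eqP; rewrite oner_eq0.
move=> x l hx /andP[l0 l1].
have [->|x0] := eqVneq x 0.
  rewrite scaler0 => u m su m0 /esym/eqP; rewrite scaler_eq0 => /orP[/eqP ->|/eqP u0].
    exact: g0.
  by move: su; rewrite /sphere /= u0 dot0l => /esym/eqP; rewrite oner_eq0.
have [u [su xE]] := sphere_decomp x0.
rewrite xE scalerA; apply/(star_body_ofE g0 su _).
  by rewrite mulr_ge0// sqrtr_ge0.
apply: (@le_trans _ _ (Num.sqrt (dot x x))%:E).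
  by rewrite lee_fin ler_piMl// sqrtr_ge0.
by apply: (hx u) => //; rewrite sqrtr_ge0.
Qed.

Lemma star_body0 A : star_set A -> A 0.
Proof. by move=> [[x Ax] h]; rewrite -(scale0r x); apply: h => //; rewrite lexx ler01. Qed.

Lemma radial_ge0 A u : A 0 -> (0 <= radial A u)%E.
Proof.
by move=> A0; apply: ereal_sup_ubound; exists 0 => //; split => //; rewrite scale0r.
Qed.

Lemma star_body_of_radial A : star_body A -> star_body_of (radial A) = A.
Proof.
move=> [sA bA]; have A0 := star_body0 sA; apply/seteqP; split => x.
  have [->//|x0] := eqVneq x 0.
  have [u [su xE]] := sphere_decomp x0 => /(_ u _ su (sqrtr_ge0 _) xE).
  set l := Num.sqrt _ in xE * => lr; have l0 : 0 <= l by exact: sqrtr_ge0.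
  rewrite xE.
  have mono (m : R) : l <= m -> A (m *: u) -> A (l *: u).
    move=> lm Am; have [m0|m0] := eqVneq m 0.
      by have -> : l = 0; [lra|rewrite scale0r].
    have -> : l *: u = (l / m) *: (m *: u) by rewrite scalerA divfK.
    apply: sA.2 => //; have mp : 0 < m by rewrite lt_neqAle eq_sym m0 (le_trans l0).
    by rewrite divr_ge0 ?(ltW mp)//= ler_pdivrMr// mul1r.
  move: lr; have := bA u su; case E : (radial A u) => [r| |]//.
    by rewrite ltry lee_fin => /(_ isT)/= Ar /mono; apply.
  move=> _ _; have : (l%:E < radial A u)%E by rewrite E ltry.
  by move=> /ereal_sup_gt[_ [m [m0 Am] <-]]; rewrite lte_fin => /ltW /mono; apply.
move=> Ax u l su l0 xE; apply: ereal_sup_ubound; exists l => //; split => //.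
by rewrite -xE.
Qed.

Lemma support_ge0 K u : K 0 -> (0 <= support K u)%E.
Proof. by move=> K0; apply: ereal_sup_ubound; exists 0 => //; rewrite dot0l. Qed.

Lemma flower_ball K x p : K 0 -> K x -> dot p p <= dot x p -> flower K p.
Proof.
move=> K0 Kx + u l su l0 pE; rewrite pE !dotE su mulr1 => h.
have [->|l00] := eqVneq l 0; first exact: support_ge0.
have lp : 0 < l by rewrite lt_neqAle eq_sym l00.
apply: (@le_trans _ _ (dot x u)%:E); first by rewrite lee_fin -(ler_pM2l lp).
by apply: ereal_sup_ubound; exists x.
Qed.

Lemma flower_approx K p (t : R) : K 0 -> flower K p -> 0 <= t < 1 ->
  exists x, K x /\ dot (t *: p) (t *: p) <= dot x (t *: p).
Proof.
move=> K0 Kp /andP[t0 t1]; have [->|p0] := eqVneq p 0.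
  by exists 0; split => //; rewrite scaler0 !dot0l.
have [u [su pE]] := sphere_decomp p0.
have := Kp u _ su (sqrtr_ge0 _) pE.
have : 0 < Num.sqrt (dot p p).
  rewrite lt_neqAle sqrtr_ge0 andbT eq_sym; apply: contra p0 => /eqP l0.
  by rewrite pE l0 scale0r.
set l := Num.sqrt _ in pE * => l0 h.
have : ((t * l)%:E < support K u)%E.
  by apply: lt_le_trans h; rewrite lte_fin; nra.
move=> /ereal_sup_gt[_ [x Kx <-]]; rewrite lte_fin => tx; exists x; split => //.
rewrite pE !dotE su; have : 0 <= t * l by nra.
by nra.
Qed.

Lemma sum_ball K T x y z : K 0 -> T 0 -> K x -> T y ->
  dot z z - dot (x + y) z <=
    (Num.sqrt (dot x x) * Num.sqrt (dot y y) - dot x y) / 2 ->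
  minkowski_sum (flower K) (flower T) z.
Proof.
move=> K0 T0 Kx Ty.
set a := Num.sqrt _; set b := Num.sqrt _.
have a0 : 0 <= a by exact: sqrtr_ge0.
have b0 : 0 <= b by exact: sqrtr_ge0.
have ha : dot x x = a ^+ 2 by rewrite sqr_sqrtr// dot_ge0.
have hb : dot y y = b ^+ 2 by rewrite sqr_sqrtr// dot_ge0.
move=> h; have [ab0|ab0] := eqVneq (a + b) 0.
  have a00 : a = 0 by lra.
  have b00 : b = 0 by lra.
  have x0 : x = 0 by apply: dot_eq0; rewrite ha a00 expr0n.
  have y0 : y = 0 by apply: dot_eq0; rewrite hb b00 expr0n.
  have z0 : z = 0.
    apply: dot_eq0; apply/eqP; rewrite eq_le dot_ge0 andbT.
    by move: h; rewrite x0 y0 addr0 !dot0l a00; lra.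
  exists 0; last exists 0; rewrite ?addr0//.
    by apply: (flower_ball K0 K0); rewrite dot0l.
  by apply: (flower_ball T0 T0); rewrite dot0l.
have ab : 0 < a + b by rewrite lt_neqAle eq_sym ab0 addr_ge0.
set s := a / (a + b); set t := b / (a + b).
have st : s + t = 1 by rewrite /s /t; field.
have sE : a = s * (a + b) by rewrite /s; field.
have tE : b = t * (a + b) by rewrite /t; field.
have [e eE] : exists e : 'rV[R]_n, e = 2 *: z + (-1) *: (x + y) by eexists.
have he : dot e e <= (a + b) ^+ 2.
  by move: h; rewrite eE !dotE (dotC z x) (dotC z y) (dotC y x) ha hb; lra.
exists (2^-1 *: (x + s *: e)).
  apply: (flower_ball K0 Kx).
  have : s ^+ 2 * dot e e <= s ^+ 2 * (a + b) ^+ 2 by rewrite ler_wpM2l// sqr_ge0.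
  rewrite -exprMn -sE !dotE (dotC e x) ha; lra.
exists (2^-1 *: (y + t *: e)).
  apply: (flower_ball T0 Ty).
  have : t ^+ 2 * dot e e <= t ^+ 2 * (a + b) ^+ 2 by rewrite ler_wpM2l// sqr_ge0.
  rewrite -exprMn -tE !dotE (dotC e y) hb; lra.
rewrite -scalerDr addrACA -scalerDl st scale1r eE addrCA scaleN1r subrr addr0.
by rewrite scalerA mulVf// scale1r.
Qed.

Lemma minkowski_sum_flower0 K T : K 0 -> T 0 ->
  minkowski_sum (flower K) (flower T) 0.
Proof. by move=> K0 T0; apply: (sum_ball K0 T0 K0 T0); rewrite !addr0 !dot0l; have := sqrtr_ge0 (0:R); nra. Qed.

Lemma dot_continuous u : continuous (fun x : 'rV[R]_n => dot x u).
Proof.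
rewrite /dot.
have -> : (fun x : 'rV[R]_n => (x *m u^T) 0 0) = (fun x : 'rV[R]_n => \sum_i x 0 i * u 0 i).
  by apply/funext => z; rewrite mxE; apply: eq_bigr => i _; rewrite mxE.
apply: (@continuous_big R^o _ +%R 0 xpredT _ _ (index_enum _) (fun i (z : 'rV[R]_n) => z 0 i * u 0 i : R^o)) => [|i _ z].
  exact: add_continuous.
apply: (@continuousM R _ (fun z : 'rV[R]_n => z 0 i) (cst (u 0 i)) z).
  exact: coord_continuous.
exact: cst_continuous.
Qed.

Lemma alexandrov_convex_body (g : 'rV[R]_n -> \bar R) :
  (forall v, sphere v -> (0 <= g v)%E) -> convex_body (alexandrov g).
Proof.
move=> g0; split.
- have -> : alexandrov g = \bigcap_(u in sphere)
      ((fun x => dot x u) @^-1` [set r | (r%:E <= g u)%E]).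
    by apply/seteqP; split => x h u; exact: h.
  apply: closed_bigI => u su; apply: preimage_closed.
    by move=> x _; exact: dot_continuous.
  have := g0 u su; case: (g u) => [r| |]// _.
  rewrite (_ : mkset _ = setT); first exact: closedT.
  by apply/seteqP; split => x //= _; rewrite leey.
- move=> x y l; rewrite !inE => hx hy u su.
  have := hx u su; have := hy u su.
  have -> : dot (conv l x y) u = l%:num * dot x u + (1 - l%:num) * dot y u.
    by rewrite -!dotZl -dotDl.
  have l0 : 0 <= l%:num by [].
  have l1 : l%:num <= 1 :> R by [].
  case: (g u) => [r| |]//; last by rewrite !leey.
  by rewrite !lee_fin; nra.
- by move=> u su; rewrite dot0l; exact: g0.
Qed.

Lemma sum_support K T x y p q u (s : R) : K 0 -> T 0 -> K x -> T y ->
  dot p p <= dot x p -> dot q q <= dot y q -> sphere u -> p + q = s *: u ->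
  0 <= s ->
  exists2 w, alexandrov (radial (minkowski_sum (flower K) (flower T))) w
           & s <= dot w u.
Proof.
move=> K0 T0 Kx Ty hp hq su pq s0.
set a := Num.sqrt (dot x x); set b := Num.sqrt (dot y y).
have hxy : dot x y <= a * b by exact: CauchySchwarz.
pose D := (a * b - dot x y) / 2; have D0 : 0 <= D by rewrite /D; lra.
have [c cE] : exists c : 'rV[R]_n, c = 2^-1 *: (x + y) by eexists.
pose S v := Num.sqrt (D + dot c v ^+ 2).
have S0 v : 0 <= S v by exact: sqrtr_ge0.
have hS v : S v ^+ 2 = D + dot c v ^+ 2 by rewrite sqr_sqrtr// addr_ge0// sqr_ge0.
have cS v : `|dot c v| <= S v.
  by rewrite -(@ler_pXn2r _ 2)// ?nnegrE// hS real_normK ?num_real//; lra.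
have hs : s <= dot c u + S u.
  have hpq : dot (p + q) (p + q) <= dot (x + y) (p + q) + D.
    pose e : 'rV[R]_n := 2 *: p + (-1) *: x; pose f : 'rV[R]_n := 2 *: q + (-1) *: y.
    have ha : dot x x = a ^+ 2 by rewrite sqr_sqrtr// dot_ge0.
    have hb : dot y y = b ^+ 2 by rewrite sqr_sqrtr// dot_ge0.
    have he : Num.sqrt (dot e e) <= a.
      by apply: ler_wsqrtr; rewrite /e !dotE (dotC p x); lra.
    have hf : Num.sqrt (dot f f) <= b.
      by apply: ler_wsqrtr; rewrite /f !dotE (dotC q y); lra.
    have hef : dot e f <= a * b.
      by apply: (le_trans (CauchySchwarz e f)); rewrite ler_pM ?sqrtr_ge0.
    move: hef; rewrite /D /e /f !dotE (dotC q p) (dotC p y) => hef.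
    by lra.
  rewrite leNgt; apply/negP => hlt.
  have hc : 2 * dot c u = dot (x + y) u by rewrite cE dotZl mulrA divff// mul1r.
  move: hpq; rewrite pq !dotE su -mulrDr -dotDl -hc => hpq.
  have := hS u; have := S0 u; nra.
have [Su0|Su0] := eqVneq (S u) 0.
  exists 0.
    move=> v sv; rewrite dot0l; apply: radial_ge0.
    exact: minkowski_sum_flower0.
  by have := cS u; rewrite Su0 normr_le0 dot0l => /eqP cu; move: hs; rewrite cu Su0; lra.
have Sp : 0 < S u by rewrite lt_neqAle eq_sym Su0 S0.
exists (c + (S u)^-1 *: (dot c u *: c + D *: u)); last first.
  rewrite !dotE su mulr1 -expr2 (addrC _ D) -hS expr2 mulrA mulVf// mul1r.
  exact: hs.
move=> v sv.
have uv : `|dot u v| <= 1.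
  have := dot_ge0 (u + v); have := dot_ge0 (u + (-1) *: v).
  by rewrite !dotE su sv (dotC v u) ler_norml => h1 h2; lra.
apply: (@le_trans _ _ (dot c v + S v)%:E).
  rewrite lee_fin !dotE lerD2l ler_pdivrMl//.
  apply: (@le_trans _ _ `|dot c u * dot c v + D * dot u v|); first exact: ler_norm.
  rewrite -(@ler_pXn2r _ 2)// ?nnegrE ?mulr_ge0// real_normK ?num_real// exprMn !hS.
  have [h1 h2] : -1 <= dot u v /\ dot u v <= 1 by move: uv; rewrite ler_norml => /andP[].
  move: (dot c u) (dot c v) (dot u v) h1 h2 => A B m h1 h2.
  have h3 : D ^+ 2 * m ^+ 2 <= D ^+ 2 * 1.
    by apply: ler_wpM2l; [exact: sqr_ge0|nra].
  have h4 : 0 <= D * ((A - m * B) ^+ 2 + (1 - m ^+ 2) * B ^+ 2).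
    apply: mulr_ge0 => //; apply: addr_ge0; first exact: sqr_ge0.
    by apply: mulr_ge0; [nra|exact: sqr_ge0].
  by lra.
apply: ereal_sup_ubound; exists (dot c v + S v) => //; split.
  by have := cS v; rewrite ler_norml => /andP[]; lra.
apply: (sum_ball K0 T0 Kx Ty); rewrite -/a -/b -/D.
have hc : 2 * dot c v = dot (x + y) v by rewrite cE dotZl mulrA divff// mul1r.
by rewrite dotZl !dotZr sv -hc; have := hS v; lra.
Qed.

Lemma reciprocal_convex_body K : convex_body K -> convex_body (reciprocal K).
Proof.
move=> [_ _ K0]; apply: alexandrov_convex_body => v _.
by rewrite inve_ge0; exact: support_ge0.
Qed.

Lemma reciprocal_bodies_stable K :
  reciprocal_bodies K -> reciprocal_bodies (reciprocal K).
Proof. by move=> [L cL <-]; exists (reciprocal L) => //; exact: reciprocal_convex_body. Qed.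

(* When the Minkowski sum of the flowers is itself a star body, the defining
   equation is literally flower W = flower K + flower T. *)
Lemma is_oplus_star_body K T W :
  star_body (minkowski_sum (flower K) (flower T)) ->
  is_oplus K T W <->
  convex_body W /\ flower W = minkowski_sum (flower K) (flower T).
Proof. by move=> /star_body_of_radial sE; rewrite /is_oplus sE. Qed.

(* xget never falls back on its default: the radial function of a sum of two
   flowers is always a support function. *)
Lemma oplusP K T : convex_body K -> convex_body T -> is_oplus K T (oplus K T).
Proof.
move=> [_ _ K0] [_ _ T0]; set r := radial (minkowski_sum (flower K) (flower T)).
have r0 v : sphere v -> (0 <= r v)%E.
  by move=> _; apply/radial_ge0/minkowski_sum_flower0.
apply: (@xgetPex _ set0 (is_oplus K T)); exists (alexandrov r); split.
  exact: alexandrov_convex_body.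
suff hr u : sphere u -> support (alexandrov r) u = r u.
  rewrite /flower; apply/seteqP; split => x h u l su l0 xE.
    by rewrite -/r -hr//; exact: h.
  by rewrite hr//; exact: h.
move=> su; apply/eqP; rewrite eq_le; apply/andP; split.
  by apply: ge_ereal_sup => _ [x hx <-]; exact: hx.
apply: ge_ereal_sup => _ [s [s0 [p Kp [q Tq pq]]] <-].
apply/lee_addgt0Pr => e e0.
pose t := s / (s + e).
have se : 0 < s + e by lra.
have t01 : 0 <= t < 1.
  by rewrite /t divr_ge0 ?(ltW se)//= ltr_pdivrMr// mul1r; lra.
have [x [Kx hx]] := flower_approx K0 Kp t01.
have [y [Ty hy]] := flower_approx T0 Tq t01.
have tpq : t *: p + t *: q = (t * s) *: u by rewrite -scalerDr pq scalerA.
have ts0 : 0 <= t * s by case/andP: t01 => ? _; rewrite mulr_ge0.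
have [w hw sw] := sum_support K0 T0 Kx Ty hx hy su tpq ts0.
apply: (@le_trans _ _ (dot w u + e)%:E).
  rewrite lee_fin; suff : s <= t * s + e by lra.
  have tE : t * (s + e) = s by rewrite /t divfK// lt0r_neq0.
  by case/andP: t01 => t0 t1; nra.
by rewrite EFinD leeD2r//; apply: ereal_sup_ubound; exists w.
Qed.

End Facts.

(* Main.v *)
Require Import Defs.
From HB Require Import structures.
From mathcomp Require Import all_boot all_order all_algebra.
From mathcomp Require Import all_classical all_reals all_analysis.
From mathcomp Require Import ring lra.
Import Order.TTheory GRing.Theory Num.Theory.
Import numFieldNormedType.Exports.

Set Implicit Arguments.
Unset Strict Implicit.
Unset Printing Implicit Defensive.

Local Open Scope classical_set_scope.
Local Open Scope ring_scope.

(** The reciprocal [K'] is the polar of the flower of [K]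
    ([reciprocalE]).  Hence polarity turns the defining equation of the sum of
    bodies, which is a Minkowski sum of flowers, into a statement on linear
    functionals.  Put [a = 1 - l].  If [x] lies in the reciprocal of the sum of
    [a K] and [l T], then [<x, p> + <x, q> <= 1] for all [p] in the flower of
    [a K] and [q] in the flower of [l T]; so with [c] the supremum of [<x, p>],
    the functional [<x, .>] is at most [c] on the first flower and at most
    [1 - c] on the second.

    For [a, l > 0] this bounds how far one can go along [x] inside the two bodies:
    [s x] lies in [a K'] as soon as [s c <= a^2], and [(1 - s) x] lies in [l T']
    as soon as [(1 - s) (1 - c) <= l^2] ([dilate_reciprocal]).  Both conditions
    hold for some [s] between 0 and 1, by the inequality
    [a^2 / c + l^2 / (1 - c) >= (a + l)^2 = 1], the same convexity of [1/t] that
    makes polarity a convex map ([polarity_split]).  Thus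
    [x = s x + (1 - s) x] belongs to the Minkowski sum of [a K'] and [l T'].

    Finally the Minkowski sum of two bodies is contained in their flower sum
    ([minkowski_sum_sub_oplus]): the sum of two flowers reaches, in each
    direction, at least the sum of the support functions.  As a flower only
    records support functions, recovering membership in the body from them is
    the separation theorem for closed convex sets, obtained here from the
    nearest point ([support_separation]). *)

(** * Separation of a point from a closed convex set *)

Section Separation.
Context {R : realType} {n : nat}.
Implicit Types (K V : set 'rV[R]_n) (x y p u : 'rV[R]_n).

Lemma dotNl x u : dot (- x) u = - dot x u.
Proof. by rewrite -scaleN1r dotZl mulN1r. Qed.

Lemma dotNr x u : dot u (- x) = - dot u x.
Proof. by rewrite dotC dotNl dotC. Qed.

(** Compares the sup norm, which carries the topology of row vectors, with the
    Euclidean norm, which carries the geometry. *)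
Lemma mx_norm_le_dot x : `|x| <= Num.sqrt (dot x x).
Proof.
rewrite [leLHS]/Num.norm /= mx_normrE; apply/bigmax_leP; split=> [|[i j] _ /=].
  exact: sqrtr_ge0.
rewrite ord1 -sqrtr_sqr; apply: ler_wsqrtr.
rewrite /dot mxE (bigD1 j)//= mxE -expr2 lerDl sumr_ge0// => k _.
by rewrite mxE -expr2 sqr_ge0.
Qed.

Lemma dist2_continuous x : continuous (fun y => dot (x - y) (x - y)).
Proof.
rewrite /dot.
have -> : (fun y : 'rV[R]_n => ((x - y) *m (x - y)^T) 0 0) =
          (fun y : 'rV[R]_n => \sum_i (x 0 i - y 0 i) ^+ 2).
  by apply/funext => y; rewrite mxE; apply: eq_bigr => i _; rewrite !mxE expr2.
apply: (@continuous_big R^o _ +%R 0 xpredT _ _ (index_enum _)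
  (fun i (y : 'rV[R]_n) => (x 0 i - y 0 i) ^+ 2 : R^o)) => [|i _ y].
  exact: add_continuous.
apply: (@continuous_comp _ _ _ (fun y : 'rV[R]_n => x 0 i - y 0 i)
  (fun t : R => t ^+ 2) y); last exact: exprn_continuous.
apply: (@continuousB _ R^o _ (cst (x 0 i)) (fun y : 'rV[R]_n => y 0 i) y).
  exact: cst_continuous.
exact: coord_continuous.
Qed.

(** Only the points of [V] at least as close to [x] as a given one compete;
    they form a compact set. *)
Lemma nearest_point V x : closed V -> V !=set0 ->
  exists2 p, V p &
    forall y, V y -> dot (x - p) (x - p) <= dot (x - y) (x - y).
Proof.
move=> cV [v Vv].
pose d y := dot (x - y) (x - y).
pose B := V `&` [set y | d y <= d v].
have cB : closed B.
  apply: closedI => //.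
  have -> : [set y | d y <= d v] = d @^-1` [set r | r <= d v] by [].
  apply: preimage_closed; last exact: closed_le.
  by move=> y _; exact: dist2_continuous.
have bB : bounded_set B.
  exists (Num.sqrt (d v) + `|x|); split; first exact: num_real.
  move=> M hM y [_ /= dy]; apply: le_trans (ltW hM).
  have -> : y = - (x - y) + x by rewrite opprB subrK.
  apply: le_trans (ler_normD _ _) _; rewrite lerD2r normrN.
  exact: le_trans (mx_norm_le_dot _) (ler_wsqrtr dy).
have Bv : B v by split => //=.
have dB : {within B, continuous d}.
  by apply: continuous_subspaceT; exact: dist2_continuous.
have [p] := EVT_min_rV (ex_intro _ v Bv) (bounded_closed_compact bB cB) dB.
rewrite inE => -[Vp dp] pmin; exists p => // y Vy.
have [dy|dy] := leP (d y) (d v); last exact: le_trans dp (ltW dy).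
by apply: pmin; rewrite inE.
Qed.

(** Otherwise a small step from [p] towards [y], which stays in [V], would come
    closer to [x]. *)
Lemma nearest_point_obtuse V x p y : convex_set V -> V p ->
  (forall z, V z -> dot (x - p) (x - p) <= dot (x - z) (x - z)) ->
  V y -> dot (y - p) (x - p) <= 0.
Proof.
move=> cV Vp pmin Vy; rewrite leNgt; apply/negP.
set m := dot (y - p) (x - p) => m0.
set d := dot (y - p) (y - p).
have d0 : 0 <= d by exact: dot_ge0.
have md : 0 < m + d by lra.
(* A step t changes the squared distance by t (t d - 2 m), and
   t = m / (m + d) is at most 1 with t d < 2 m, also when d = 0. *)
pose t := m / (m + d).
have t0 : 0 < t by exact: divr_gt0.
have t1 : t <= 1 by rewrite ler_pdivrMr// mul1r; lra.
have tE : t * (m + d) = m by rewrite /t divfK// lt0r_neq0.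
have Vz : V (t *: y + (1 - t) *: p).
  have := cV y p (Itv01 (ltW t0) t1); rewrite !inE => h.
  exact: h.
have := pmin _ Vz.
have -> : x - (t *: y + (1 - t) *: p) = (x - p) - t *: (y - p).
  by apply/rowP => i; rewrite !mxE; ring.
(* The vectors x - p and y - p stay whole when the products are expanded. *)
move: (x - p) (y - p) @m @d m0 d0 md @t t0 t1 tE {Vz}.
move=> w v m d m0 d0 md t t0 t1 tE.
rewrite !dotDl !dotDr !dotNl !dotNr !dotZl !dotZr (dotC w v) -/m -/d.
nra.
Qed.

(** The unit vector from the nearest point [p] of [V] towards [x] would violate
    the hypothesis if [x] were outside [V], since [V] attains its support
    function in that direction at [p]. *)
Lemma support_separation V x : convex_body V ->
  (forall u, sphere u -> ((dot x u)%:E <= Defs.support V u)%E) -> V x.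
Proof.
move=> [clV cV V0] h.
have [p Vp pmin] : exists2 p, V p &
    forall y, V y -> dot (x - p) (x - p) <= dot (x - y) (x - y).
  by apply: nearest_point => //; exists 0.
have [/eqP|xp] := eqVneq (x - p) 0; first by rewrite subr_eq0 => /eqP ->.
have [u [su xpE]] := sphere_decomp xp.
set r := Num.sqrt _ in xpE.
have r0 : 0 < r.
  rewrite lt_neqAle sqrtr_ge0 andbT eq_sym; apply: contra xp => /eqP r0.
  by rewrite xpE r0 scale0r.
have : (Defs.support V u <= (dot p u)%:E)%E.
  apply: ge_ereal_sup => _ [y Vy <-]; rewrite lee_fin.
  have := nearest_point_obtuse cV Vp pmin Vy.
  by rewrite xpE dotZr pmulr_rle0// dotDl dotNl subr_le0.
move=> /(le_trans (h u su)); rewrite lee_fin -subr_le0 -dotNl -dotDl xpE.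
by rewrite dotZl su mulr1 leNgt r0.
Qed.

End Separation.

(** * Flowers, reciprocals and sums of bodies *)

Section FlowerPolarity.
Context {R : realType} {n : nat}.
Implicit Types (K T A B : set 'rV[R]_n) (x y p q u : 'rV[R]_n).

Lemma flowerE K u (l : R) : K 0 -> sphere u -> 0 <= l ->
  flower K (l *: u) <-> (l%:E <= Defs.support K u)%E.
Proof. by move=> K0; apply: star_body_ofE => v _; exact: support_ge0. Qed.

Lemma flower0 K : K 0 -> flower K 0.
Proof. by move=> K0; apply: (flower_ball K0 K0); rewrite dot0l. Qed.

(** On the ray spanned by [u], the flower is the segment of length
    [support K u], so the inequality [dot x u <= 1 / support K u] is polarity
    with respect to that segment. *)
Lemma reciprocalE K x : K 0 ->
  reciprocal K x <-> forall p, flower K p -> dot x p <= 1.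
Proof.
move=> K0; split=> [Kx p|h u su].
  have [->|p0] := eqVneq p 0; first by rewrite dotC dot0l.
  have [u [su]] := sphere_decomp p0.
  set l := Num.sqrt _ => pE.
  have l0 : 0 < l.
    rewrite lt_neqAle sqrtr_ge0 andbT eq_sym; apply: contra p0 => /eqP l0.
    by rewrite pE l0 scale0r.
  rewrite pE (flowerE K0 su (ltW l0)) dotZr => lh.
  have : ((dot x u)%:E <= (l%:E)^-1)%E.
    apply: le_trans (Kx u su) _.
    by rewrite lee_pV2 ?inE ?lee_fin ?(ltW l0)//; exact: support_ge0.
  by rewrite inver (gt_eqF l0) lee_fin -(ler_pM2l l0) divff ?gt_eqF.
have := support_ge0 u K0.
have hl (l : R) : 0 <= l -> (l%:E <= Defs.support K u)%E -> l * dot x u <= 1.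
  by move=> l0 /(flowerE K0 su l0)/h; rewrite dotZr.
case E : (Defs.support K u) hl => [r| |] hl //.
  rewrite lee_fin inver => r0; have [_|r00] := eqVneq r 0; first exact: leey.
  have rp : 0 < r by rewrite lt_neqAle eq_sym r00.
  by rewrite lee_fin -(ler_pM2l rp) divff// hl.
move=> _; rewrite invey lee_fin leNgt; apply/negP => xu.
(* The whole ray of u lies in the flower, in particular a point at which the
   functional takes the value 2. *)
have := hl (2 / dot x u); rewrite leey divfK ?gt_eqF// divr_ge0 ?(ltW xu)//.
by move=> /(_ isT isT); lra.
Qed.

(** Only an inclusion: the flower of the sum is the star body with the same
    radial function, which may contain additional boundary points. *)
Lemma minkowski_sum_flower_sub K T : convex_body K -> convex_body T ->
  minkowski_sum (flower K) (flower T) `<=` flower (oplus K T).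
Proof.
move=> cK cT; have [_ ->] := oplusP cK cT => z hz u l _ l0 zE.
by apply: ereal_sup_ubound; exists l => //; split => //; rewrite -zE.
Qed.

(** In the direction [u], the flowers of [A] and [B] contain the multiples of
    [u] by the positive parts of [dot x u] and [dot y u]; their sum shows that
    the support function of the sum is at least [dot (x + y) u]. *)
Lemma minkowski_sum_sub_oplus A B : convex_body A -> convex_body B ->
  minkowski_sum A B `<=` oplus A B.
Proof.
move=> cA cB _ [x Ax [y By <-]].
have [cW _] := oplusP cA cB; have [_ _ W0] := cW.
apply: (support_separation cW) => u su.
have ray K z : K 0 -> K z -> flower K (Num.max 0 (dot z u) *: u).
  move=> K0 Kz; apply: (flower_ball K0 Kz).
  by rewrite !dotZr dotZl su; case: (ltP 0 (dot z u)) => _; lra.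
have [[_ _ A0] [_ _ B0]] := (cA, cB).
apply: (@le_trans _ _ (Num.max 0 (dot x u) + Num.max 0 (dot y u))%:E).
  by rewrite lee_fin dotDl lerD// le_max lexx orbT.
apply/(flowerE W0 su); first by rewrite addr_ge0// le_max lexx.
rewrite scalerDl; apply: (minkowski_sum_flower_sub cA cB).
exists (Num.max 0 (dot x u) *: u); first exact: ray.
by exists (Num.max 0 (dot y u) *: u) => //; exact: ray.
Qed.

Lemma dilate_convex_body (a : R) K : convex_body K ->
  convex_body (dilate a K).
Proof.
move=> [clK cK K0]; split; last by exists 0; rewrite ?scaler0.
- have [->|a0] := eqVneq a 0.
    have -> : dilate 0 K = [set 0].
      apply/seteqP; split => [_ [x _ <-]|_ ->]; first by rewrite /= scale0r.
      by exists 0; rewrite ?scaler0.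
    exact/accessible_closed_set1/hausdorff_accessible/norm_hausdorff.
  have -> : dilate a K = (fun x => a^-1 *: x) @^-1` K.
    apply/seteqP; split => [_ [x Kx <-]|x Kx] /=.
      by rewrite scalerA mulVf// scale1r.
    by exists (a^-1 *: x); rewrite ?scalerA ?divff ?scale1r.
  by apply: preimage_closed => // x _; exact: scaler_continuous.
- move=> _ _ t /set_mem[x Kx <-] /set_mem[y Ky <-]; apply/mem_set.
  exists (t%:num *: x + (1 - t%:num) *: y).
    by have := cK x y t; rewrite !inE => h; exact: h.
  by rewrite scalerDr !scalerA !(mulrC a) -!scalerA.
Qed.

(** Dilation multiplies the support function, hence the radial function. *)
Lemma flower_dilate K (a : R) p : K 0 -> 0 < a -> flower K p ->
  flower (dilate a K) (a *: p).
Proof.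
move=> K0 a0 Kp u l su l0 pE.
have : ((l / a)%:E <= Defs.support K u)%E.
  apply: (Kp u) => //; first by rewrite divr_ge0// ltW.
  by rewrite mulrC -scalerA -pE scalerA mulVf ?gt_eqF// scale1r.
move=> h; rewrite -[l](@divfK _ a) ?gt_eqF// mulrC.
have -> : Defs.support (dilate a K) u = (a%:E * Defs.support K u)%E.
  rewrite /Defs.support -ereal_sup_pZl// /dilate !image_comp; congr ereal_sup.
  by apply: eq_imagel => x _ /=; rewrite dotZl EFinM.
by rewrite EFinM lee_pmul2l.
Qed.

(** Two factors [a] occur because the flower of [a K] is [a] times that of [K],
    so its polar is [1/a] times [K'], whereas the target is [a] times [K'].  For
    [a = 0] the target is the origin, which forces [s = 0]. *)
Lemma dilate_reciprocal K (a s : R) x : convex_body K -> 0 <= a ->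
  (a = 0 -> s = 0) ->
  (forall p, flower (dilate a K) p -> s * dot x p <= a ^+ 2) ->
  dilate a (reciprocal K) (s *: x).
Proof.
move=> cK a0 as0 h; have [_ _ K0] := cK.
have [a00|a00] := eqVneq a 0.
  have [_ _ R0] := reciprocal_convex_body cK.
  by exists 0; rewrite // (as0 a00) scale0r scaler0.
have ap : 0 < a by rewrite lt_neqAle eq_sym a00.
exists ((s / a) *: x); last by rewrite scalerA mulrC divfK.
apply/(reciprocalE _ K0) => p Kp.
have /h : flower (dilate a K) (a *: p) by exact: flower_dilate.
rewrite dotZr dotZl expr2 mulrCA ler_pM2l// => hp.
by rewrite mulrAC ler_pdivrMr// mul1r.
Qed.

End FlowerPolarity.

(** * Convexity of polarity *)

(** In the nondegenerate case [s] is proportional to [a^2 / c] and [1 - s] to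
    [l^2 / (1 - c)].  After clearing denominators both bounds reduce to
    [c (1 - c) <= a^2 (1 - c) + l^2 c], whose two sides differ by
    [(a - c)^2]. *)
Lemma polarity_split (R : realFieldType) (a l c : R) :
  0 <= a -> 0 <= l -> a + l = 1 -> 0 <= c <= 1 ->
  exists2 s, 0 <= s <= 1 & [/\ a = 0 -> s = 0, l = 0 -> 1 - s = 0,
    s * c <= a ^+ 2 & (1 - s) * (1 - c) <= l ^+ 2].
Proof.
move=> a0 l0 al /andP[c0 c1].
have [l00|l00] := eqVneq l 0.
  have -> : a = 1 by lra.
  by exists 1; [lra|split; [lra|lra|lra|rewrite subrr mul0r sqr_ge0]].
have [a00|a00] := eqVneq a 0.
  have -> : l = 1 by lra.
  by exists 0; [lra|split; [lra|lra|rewrite mul0r sqr_ge0|lra]].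
have ap : 0 < a by rewrite lt_neqAle eq_sym a00.
have lp : 0 < l by rewrite lt_neqAle eq_sym l00.
have lE : l = 1 - a by lra.
pose D := a ^+ 2 * (1 - c) + l ^+ 2 * c.
have a2 : 0 < a ^+ 2 by rewrite exprn_gt0.
have l2 : 0 < l ^+ 2 by rewrite exprn_gt0.
have D0 : 0 < D.
  rewrite /D; have [->|c00] := eqVneq c 0; first by lra.
  apply: ltr_wpDl; first by rewrite mulr_ge0 ?(ltW a2)// subr_ge0.
  by rewrite mulr_gt0// lt_neqAle eq_sym c00.
have cD : c * (1 - c) <= D.
  by have := sqr_ge0 (a - c); rewrite /D lE; nra.
have sE : 1 - a ^+ 2 * (1 - c) / D = l ^+ 2 * c / D.
  by rewrite /D; field; rewrite -/D gt_eqF.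
exists (a ^+ 2 * (1 - c) / D).
  rewrite divr_ge0 ?(ltW D0) ?mulr_ge0 ?(ltW a2) ?subr_ge0//=.
  by rewrite ler_pdivrMr// mul1r /D; nra.
split; [lra|lra| |].
  by rewrite mulrAC ler_pdivrMr// -mulrA ler_pM2l// mulrC.
by rewrite sE mulrAC ler_pdivrMr// -mulrA ler_pM2l.
Qed.

Theorem proposition46 (R : realType) (n : nat) (K T : set 'rV[R]_n) (l : R)
    (hK : reciprocal_bodies K) (hT : reciprocal_bodies T) (hl : 0 <= l <= 1) :
  reciprocal (oplus (dilate (1 - l) K) (dilate l T)) `<=`
  oplus (dilate (1 - l) (reciprocal K)) (dilate l (reciprocal T)).
Proof.
move=> x hx; have /andP[l0 l1] := hl.
have a0 : 0 <= 1 - l by lra.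
have [cK cT] : convex_body K /\ convex_body T.
  by case: hK hT => [A cA <-] [B cB <-]; split; exact: reciprocal_convex_body.
have cKl := dilate_convex_body (1 - l) cK.
have cTl := dilate_convex_body l cT.
have [[_ _ K0] [_ _ T0]] := (cKl, cTl).
have [[_ _ W0] _] := oplusP cKl cTl.
have sum1 p q : flower (dilate (1 - l) K) p -> flower (dilate l T) q ->
    dot x p + dot x q <= 1.
  move=> Kp Tq; rewrite -dotDr; apply: (reciprocalE x W0).1 => //.
  by apply: (minkowski_sum_flower_sub cKl cTl); exists p => //; exists q.
pose E := [set dot x p | p in flower (dilate (1 - l) K)].
have E0 : E 0 by exists 0; [exact: flower0|rewrite dotC dot0l].
have E1 : ubound E 1.
  move=> _ [p Kp <-]; have := sum1 p 0 Kp (flower0 T0).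
  by rewrite (dotC x 0) dot0l addr0.
have c0 : 0 <= sup E by apply: ub_le_sup => //; exists 1.
have c1 : sup E <= 1 by apply: ge_sup => //; exists 0.
have hc p : flower (dilate (1 - l) K) p -> dot x p <= sup E.
  by move=> Kp; apply: ub_le_sup; [exists 1|exists p].
have hd q : flower (dilate l T) q -> dot x q <= 1 - sup E.
  move=> Tq; rewrite lerBrDl -lerBrDr; apply: ge_sup; first by exists 0.
  by move=> _ [p Kp <-]; rewrite lerBrDr; exact: sum1.
have c01 : 0 <= sup E <= 1 by rewrite c0 c1.
have [s /andP[s0 s1] [sa sl sc sd]] :=
  polarity_split a0 l0 (subrK _ _) c01.
apply: minkowski_sum_sub_oplus.
- exact/dilate_convex_body/reciprocal_convex_body.
- exact/dilate_convex_body/reciprocal_convex_body.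
exists (s *: x).
  apply: dilate_reciprocal => // p /hc hp.
  by apply: le_trans sc; exact: ler_wpM2l.
exists ((1 - s) *: x); last by rewrite -scalerDl subrKC scale1r.
apply: dilate_reciprocal => // q /hd hq.
by apply: le_trans sd; apply: ler_wpM2l; rewrite ?subr_ge0.
Qed.
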